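(* Let $\mathbb{F}_q$ be a finite field of odd characteristic and let $\epsilon,\delta\in\mathbb{F}_q$ with $\epsilon(\delta^2-\epsilon)\neq0$ and $\delta\neq 0$. Let $w$ be the function on the Jacobi quartic curve $J_{\epsilon,\delta}: y^2=\epsilon x^4+2\delta x^2+1$ over $\mathbb{F}_q$ given by $w(x,y)=\delta x^2$. Let $P_1,P_2$ be two points of $J_{\epsilon,\delta}(\mathbb{F}_q)$ and write $w_0=w(P_2-P_1)$, $w_1=w(P_1)$, $w_2=w(P_2)$, $w_3=w(P_1+P_2)$, $w_4=w(2P_1)$. If $w_i\in\mathbb{F}_q$ for $i=0,1,2,3,4$ (i.e. $w$ has a finite value at each of these points), $w_1w_2\neq\delta^2/\epsilon$ and $w_1^2\neq\delta^2/\epsilon$, then $$w_4=\frac{4w_1(tw_1^2+1+2w_1)}{(tw_1^2-1)^2},\qquad w_3w_0=\frac{(w_1-w_2)^2}{(tw_1w_2-1)^2},$$ where $t=\epsilon/\delta^2$.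
   Context: The Jacobi quartic curve $J_{\epsilon,\delta}$ is regarded as an elliptic curve through its smooth projective model $X^2=TZ$, $Y^2=\epsilon T^2+2\delta X^2+Z^2$ in $\mathbb{P}^3$ with coordinates $(X:Y:T:Z)$, the affine point $(x,y)$ being $(x:y:x^2:1)$; the points with $Z=0$ are $(0:\pm\sqrt{\epsilon}:1:0)$ ($\mathbb{F}_q$-rational exactly when $\epsilon$ is a square). The identity is $(0,1)$, $-(x,y)=(-x,y)$, and addition is generically $$(x_1,y_1)+(x_2,y_2)=\left(\frac{x_1y_2+x_2y_1}{1-\epsilon x_1^2x_2^2},\ \frac{(y_1y_2+2\delta x_1x_2)(1+\epsilon x_1^2x_2^2)+2\epsilon x_1x_2(x_1^2+x_2^2)}{(1-\epsilon x_1^2x_2^2)^2}\right).$$ *)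

(* Defs.v *)
From mathcomp Require Import all_boot all_algebra.
From mathcomp Require Import generic_quotient ring.

Set Implicit Arguments.
Unset Strict Implicit.
Unset Printing Implicit Defensive.

Import GRing.Theory.
Local Open Scope ring_scope.
Local Open Scope quotient_scope.

(* Homogeneous coordinates (X, Y, T, Z) in P^3. *)
Notation hcoords F := (F * F * F * F)%type.

Definition hcoords0 (F : finFieldType) : hcoords F := (0, 0, 0, 0).

Definition hscale (F : finFieldType) (c : F) (u : hcoords F) : hcoords F :=
  let: (X, Y, T, Z) := u in (c * X, c * Y, c * T, c * Z).

Definition on_jq (F : finFieldType) (eps delta : F) : pred (hcoords F) :=
  fun u => let: (X, Y, T, Z) := u in
  [&& u != hcoords0 F, X ^+ 2 == T * Z
    & Y ^+ 2 == eps * T ^+ 2 + 2 * delta * X ^+ 2 + Z ^+ 2].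

Notation jq_rep eps delta := {u : hcoords _ | on_jq eps delta u}.

Definition jq_proportional (F : finFieldType) (eps delta : F) :
    rel (jq_rep eps delta) :=
  fun p q => [exists c : F, (c != 0) && (val q == hscale c (val p))].

Section Points.
Variables (F : finFieldType) (eps delta : F).

Lemma hscale1 (u : hcoords F) : hscale 1 u = u.
Proof. by case: u => [[[X Y] T] Z]; rewrite /= !mul1r. Qed.

Lemma hscaleA (a b : F) (u : hcoords F) : hscale a (hscale b u) = hscale (a * b) u.
Proof. by case: u => [[[X Y] T] Z]; rewrite /= !mulrA. Qed.

Lemma jq_proportional_refl : reflexive (@jq_proportional F eps delta).
Proof.
by move=> p; apply/existsP; exists 1; rewrite oner_neq0 hscale1 eqxx.
Qed.

Lemma jq_proportional_sym : symmetric (@jq_proportional F eps delta).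
Proof.
suff H p q : @jq_proportional F eps delta p q -> @jq_proportional F eps delta q p.
  by move=> p q; apply/idP/idP; apply: H.
case/existsP=> c /andP[c0 /eqP Eq]; apply/existsP; exists c^-1.
by rewrite invr_eq0 c0 Eq hscaleA mulVf // hscale1 eqxx.
Qed.

Lemma jq_proportional_trans : transitive (@jq_proportional F eps delta).
Proof.
move=> q p r /existsP[c /andP[c0 /eqP Eq]] /existsP[d /andP[d0 /eqP Er]].
by apply/existsP; exists (d * c); rewrite mulf_neq0 // Er Eq hscaleA eqxx.
Qed.

Canonical jq_equiv :=
  EquivRel (@jq_proportional F eps delta) jq_proportional_refl jq_proportional_sym jq_proportional_trans.

End Points.

(* J_{eps,delta}(F), as a set of points of P^3(F). *)
Notation jq eps delta := {eq_quot (jq_equiv eps delta)}.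

(* The value of the rational function delta * x ^ 2, with x = X / Z, at a      *)
(* point; None stands for a pole.  On the curve Z = 0 forces X = 0 and T != 0, *)
(* so that x = T / X has a pole at the points with Z = 0, and only there.      *)
Definition jq_w (F : finFieldType) (eps delta : F) (P : jq eps delta) : option F :=
  let: (X, Y, T, Z) := val (repr P) in
  if Z == 0 then None else Some (delta * (X / Z) ^+ 2).

Definition hopp (F : finFieldType) (u : hcoords F) : hcoords F :=
  let: (X, Y, T, Z) := u in (- X, Y, T, Z).

(* The homogenization of the addition formula                                  *)
(*   x3 = (x1 y2 + x2 y1) / (1 - eps x1^2 x2^2),                               *)
(*   y3 = ((y1 y2 + 2 delta x1 x2) (1 + eps x1^2 x2^2)                         *)
(*         + 2 eps x1 x2 (x1^2 + x2^2)) / (1 - eps x1^2 x2^2)^2.               *)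
Definition haddl (F : finFieldType) (eps delta : F) (u1 u2 : hcoords F) : hcoords F :=
  let: (X1, Y1, T1, Z1) := u1 in
  let: (X2, Y2, T2, Z2) := u2 in
  let N := X1 * Y2 + X2 * Y1 in
  let D := Z1 * Z2 - eps * T1 * T2 in
  (N * D,
   (Y1 * Y2 + 2 * delta * X1 * X2) * (Z1 * Z2 + eps * T1 * T2)
     + 2 * eps * X1 * X2 * (T1 * Z2 + T2 * Z1),
   N ^+ 2, D ^+ 2).

(* The same rational map, written as                                           *)
(*   x3 = (x1^2 - x2^2) / (x1 y2 - x2 y1),                                     *)
(*   y3 = ((x1^2 + x2^2) (y1 y2 - 2 delta x1 x2)                               *)
(*         - 2 x1 x2 (1 + eps x1^2 x2^2)) / (x1 y2 - x2 y1)^2.                 *)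
(* It is needed at the pairs of points where all the forms in haddl vanish.    *)
(* The two laws are proportional (haddl_haddr_prop), take values on the curve  *)
(* (haddl_curve, haddr_curve) and never vanish simultaneously                  *)
(* (hadd_no_common_zero), so that together they define a morphism J x J -> J;  *)
(* it agrees with the generic addition formula (jq_add_affine), hence it is    *)
(* the group law of the elliptic curve.                                        *)
Definition haddr (F : finFieldType) (eps delta : F) (u1 u2 : hcoords F) : hcoords F :=
  let: (X1, Y1, T1, Z1) := u1 in
  let: (X2, Y2, T2, Z2) := u2 in
  let N := T1 * Z2 - T2 * Z1 in
  let D := X1 * Y2 - X2 * Y1 in
  (N * D,
   (T1 * Z2 + T2 * Z1) * (Y1 * Y2 - 2 * delta * X1 * X2)
     - 2 * X1 * X2 * (Z1 * Z2 + eps * T1 * T2),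
   N ^+ 2, D ^+ 2).

Definition hadd (F : finFieldType) (eps delta : F) (u1 u2 : hcoords F) : hcoords F :=
  if haddl eps delta u1 u2 != hcoords0 F
  then haddl eps delta u1 u2 else haddr eps delta u1 u2.

Section GroupLaw.
Variables (F : finFieldType) (eps delta : F).

Lemma hcoords_eq (X Y T Z X' Y' T' Z' : F) :
  ((X, Y, T, Z) == (X', Y', T', Z'))
  = [&& X == X', Y == Y', T == T' & Z == Z'].
Proof. by rewrite -[LHS]/([&& _ && _ && _ & _]) -!andbA. Qed.

Lemma on_jq_hopp u : on_jq eps delta u -> on_jq eps delta (hopp u).
Proof.
case: u => [[[X Y] T] Z]; rewrite /on_jq /hcoords0 /= !hcoords_eq.
by rewrite oppr_eq0 sqrrN.
Qed.

Lemma haddl_curve (X1 Y1 T1 Z1 X2 Y2 T2 Z2 : F) :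
  X1 ^+ 2 = T1 * Z1 -> Y1 ^+ 2 = eps * T1 ^+ 2 + 2 * delta * X1 ^+ 2 + Z1 ^+ 2 ->
  X2 ^+ 2 = T2 * Z2 -> Y2 ^+ 2 = eps * T2 ^+ 2 + 2 * delta * X2 ^+ 2 + Z2 ^+ 2 ->
  let: (X, Y, T, Z) := haddl eps delta (X1, Y1, T1, Z1) (X2, Y2, T2, Z2) in
  X ^+ 2 = T * Z /\ Y ^+ 2 = eps * T ^+ 2 + 2 * delta * X ^+ 2 + Z ^+ 2.
Proof.
move=> hX1 + hX2; rewrite hX1 hX2 => hY1 hY2 /=; split; first ring.
ring: hX1 hX2 hY1 hY2.
Qed.

Lemma haddr_curve (X1 Y1 T1 Z1 X2 Y2 T2 Z2 : F) :
  X1 ^+ 2 = T1 * Z1 -> Y1 ^+ 2 = eps * T1 ^+ 2 + 2 * delta * X1 ^+ 2 + Z1 ^+ 2 ->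
  X2 ^+ 2 = T2 * Z2 -> Y2 ^+ 2 = eps * T2 ^+ 2 + 2 * delta * X2 ^+ 2 + Z2 ^+ 2 ->
  let: (X, Y, T, Z) := haddr eps delta (X1, Y1, T1, Z1) (X2, Y2, T2, Z2) in
  X ^+ 2 = T * Z /\ Y ^+ 2 = eps * T ^+ 2 + 2 * delta * X ^+ 2 + Z ^+ 2.
Proof.
move=> hX1 + hX2; rewrite hX1 hX2 => hY1 hY2 /=; split; first ring.
ring: hX1 hX2 hY1 hY2.
Qed.

Lemma haddl_haddr_prop (X1 Y1 T1 Z1 X2 Y2 T2 Z2 : F) :
  X1 ^+ 2 = T1 * Z1 -> Y1 ^+ 2 = eps * T1 ^+ 2 + 2 * delta * X1 ^+ 2 + Z1 ^+ 2 ->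
  X2 ^+ 2 = T2 * Z2 -> Y2 ^+ 2 = eps * T2 ^+ 2 + 2 * delta * X2 ^+ 2 + Z2 ^+ 2 ->
  let: (X, Y, T, Z) := haddl eps delta (X1, Y1, T1, Z1) (X2, Y2, T2, Z2) in
  let: (X', Y', T', Z') := haddr eps delta (X1, Y1, T1, Z1) (X2, Y2, T2, Z2) in
  [/\ X * Y' = X' * Y, X * T' = X' * T & X * Z' = X' * Z]
  /\ [/\ Y * T' = Y' * T, Y * Z' = Y' * Z & T * Z' = T' * Z].
Proof.
move=> hX1 + hX2; rewrite hX1 hX2 => hY1 hY2 /=.
by split; split; ring: hX1 hX2 hY1 hY2.
Qed.

Hypothesis char_odd : 2%N \notin [pchar F].
Hypothesis nonsing : eps * (delta ^+ 2 - eps) != 0.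

Let two_neq0 : (2 : F) != 0.
Proof. by apply: contra char_odd => /eqP h; rewrite inE /= h eqxx. Qed.

Let eps_neq0 : eps != 0.
Proof. by move: nonsing; rewrite mulf_eq0 negb_or => /andP[]. Qed.

Lemma hadd_no_common_zero (X1 Y1 T1 Z1 X2 Y2 T2 Z2 : F) :
  on_jq eps delta (X1, Y1, T1, Z1) -> on_jq eps delta (X2, Y2, T2, Z2) ->
  haddl eps delta (X1, Y1, T1, Z1) (X2, Y2, T2, Z2) = hcoords0 F ->
  haddr eps delta (X1, Y1, T1, Z1) (X2, Y2, T2, Z2) = hcoords0 F -> False.
Proof.
rewrite /on_jq /hcoords0 /= !hcoords_eq.
move=> /and3P[u1 /eqP hX1 /eqP hY1] /and3P[u2 /eqP hX2 /eqP hY2].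
case=> _ _ /eqP; rewrite expf_eq0 /= => /eqP N0.
move=> /eqP; rewrite expf_eq0 /= => /eqP D0.
case=> _ _ /eqP; rewrite expf_eq0 /= => /eqP N0'.
move=> /eqP; rewrite expf_eq0 /= => /eqP D0'.
have infty X Y T Z : X ^+ 2 = T * Z ->
    Y ^+ 2 = eps * T ^+ 2 + 2 * delta * X ^+ 2 + Z ^+ 2 ->
    ~~ [&& X == 0, Y == 0, T == 0 & Z == 0] -> Z = 0 -> T != 0.
  move=> hX hY u Z0; apply/eqP => T0; move: hX hY u.
  rewrite {}T0 {}Z0 mul0r => /eqP; rewrite expf_eq0 /= => /eqP->.
  rewrite !expr0n /= !mulr0 !addr0 => /eqP; rewrite expf_eq0 /= => /eqP->.
  by rewrite !eqxx.
have Z1n0 : Z1 != 0.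
  apply/eqP => Z10; have T1n0 := infty _ _ _ _ hX1 hY1 u1 Z10.
  have Z20 : Z2 = 0.
    by move/eqP: N0'; rewrite Z10 mulr0 subr0 mulf_eq0 (negPf T1n0) => /eqP.
  have T2n0 := infty _ _ _ _ hX2 hY2 u2 Z20.
  move/eqP: D0; rewrite Z10 mul0r sub0r oppr_eq0 !mulf_eq0.
  by rewrite (negPf eps_neq0) (negPf T1n0) (negPf T2n0).
have Z2n0 : Z2 != 0.
  apply/eqP => Z20; have T2n0 := infty _ _ _ _ hX2 hY2 u2 Z20.
  move/eqP: N0'; rewrite Z20 mulr0 sub0r oppr_eq0 mulf_eq0.
  by rewrite (negPf T2n0) (negPf Z1n0).
have /eqP : 2 * (X2 * Y1) = 0.
  by rewrite -[RHS](subrr 0) -{1}N0 -D0'; ring.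
rewrite !mulf_eq0 (negPf two_neq0) /= => X2Y1.
have [T1n0 T2n0] : T1 != 0 /\ T2 != 0.
  have : eps * T1 * T2 != 0.
    by rewrite -(subr0_eq D0) mulf_neq0.
  by rewrite !mulf_eq0 !negb_or -andbA => /and3P[].
have X2n0 : X2 != 0 by rewrite -sqrf_eq0 hX2 mulf_neq0.
have Y10 : Y1 = 0 by move: X2Y1; rewrite (negPf X2n0) => /eqP.
(* t := T1 / Z1 = T2 / Z2 satisfies eps t^2 = 1 and 2 + 2 delta t = 0 *)
have e1 : eps * T1 ^+ 2 = Z1 ^+ 2.
  apply: (mulfI Z2n0); apply/eqP; rewrite -subr_eq0; apply/eqP.
  have -> : Z2 * (eps * T1 ^+ 2) - Z2 * Z1 ^+ 2
    = eps * T1 * (T1 * Z2 - T2 * Z1) - Z1 * (Z1 * Z2 - eps * T1 * T2) by ring.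
  by rewrite N0' D0 !mulr0 subrr.
have e2 : Z1 + delta * T1 = 0.
  move: hY1; rewrite Y10 e1 hX1 expr0n /= => /esym /eqP.
  have -> : Z1 ^+ 2 + 2 * delta * (T1 * Z1) + Z1 ^+ 2
          = 2 * Z1 * (Z1 + delta * T1) by ring.
  by rewrite !mulf_eq0 (negPf two_neq0) (negPf Z1n0) /= => /eqP.
move: nonsing; rewrite mulf_eq0 (negPf eps_neq0) /= => /eqP; apply.
apply: (mulfI (expf_neq0 2 T1n0)); rewrite mulr0 mulrBr [_ * eps]mulrC e1.
have -> : Z1 = - (delta * T1) by apply/eqP; rewrite -addr_eq0 e2.
by ring.
Qed.

Lemma on_jq_hadd u1 u2 :
  on_jq eps delta u1 -> on_jq eps delta u2 -> on_jq eps delta (hadd eps delta u1 u2).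
Proof.
case: u1 u2 => [[[X1 Y1] T1] Z1] [[[X2 Y2] T2] Z2] h1 h2.
have noz := hadd_no_common_zero h1 h2.
move: h1 h2 => /and3P[_ /eqP hX1 /eqP hY1] /and3P[_ /eqP hX2 /eqP hY2].
have cl := haddl_curve hX1 hY1 hX2 hY2; have cr := haddr_curve hX1 hY1 hX2 hY2.
have onP v : v != hcoords0 F ->
    (let: (X, Y, T, Z) := v in
     X ^+ 2 = T * Z /\ Y ^+ 2 = eps * T ^+ 2 + 2 * delta * X ^+ 2 + Z ^+ 2) ->
    on_jq eps delta v.
  case: v => [[[X Y] T] Z] v0 [c1 c2].
  by rewrite /on_jq v0 /=; apply/andP; split; apply/eqP.
rewrite /hadd; case: ifP => [l0|/negbFE/eqP l0]; apply: onP => //.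
by apply/eqP; apply: noz.
Qed.

Definition jq_rep_add (p q : jq_rep eps delta) : jq_rep eps delta :=
  exist _ (hadd eps delta (val p) (val q)) (on_jq_hadd (valP p) (valP q)).

Definition jq_add (P Q : jq eps delta) : jq eps delta :=
  \pi_(jq eps delta) (jq_rep_add (repr P) (repr Q)).

Definition jq_rep_opp (p : jq_rep eps delta) : jq_rep eps delta :=
  exist _ (hopp (val p)) (on_jq_hopp (valP p)).

Definition jq_opp (P : jq eps delta) : jq eps delta :=
  \pi_(jq eps delta) (jq_rep_opp (repr P)).

Definition jq_sub (P Q : jq eps delta) : jq eps delta := jq_add P (jq_opp Q).

Lemma repr_pi (p : jq_rep eps delta) :
  exists2 c : F, c != 0 & val (repr (\pi_(jq eps delta) p)) = hscale c (val p).
Proof.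
have /eqmodP/existsP[c /andP[c0 /eqP ->]] : p = repr (\pi_(jq eps delta) p) %[mod jq eps delta].
  by rewrite reprK.
by exists c.
Qed.

Lemma eq_jq (p q : jq_rep eps delta) (c : F) :
  c != 0 -> val q = hscale c (val p) -> p = q %[mod jq eps delta].
Proof. by move=> c0 h; apply/eqmodP/existsP; exists c; rewrite c0 h eqxx. Qed.

Lemma hscale_eq0 (c : F) u : c != 0 -> (hscale c u == hcoords0 F) = (u == hcoords0 F).
Proof.
case: u => [[[X Y] T] Z] c0.
by rewrite /hcoords0 /= !hcoords_eq !mulf_eq0 (negPf c0).
Qed.

Lemma hadd_scale (c d : F) u v : c != 0 -> d != 0 ->
  hadd eps delta (hscale c u) (hscale d v) = hscale ((c * d) ^+ 2) (hadd eps delta u v).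
Proof.
move=> c0 d0; rewrite /hadd.
have -> : haddl eps delta (hscale c u) (hscale d v) = hscale ((c * d) ^+ 2) (haddl eps delta u v).
  by case: u v => [[[? ?] ?] ?] [[[? ?] ?] ?] /=; congr (_, _, _, _); ring.
have -> : haddr eps delta (hscale c u) (hscale d v) = hscale ((c * d) ^+ 2) (haddr eps delta u v).
  by case: u v => [[[? ?] ?] ?] [[[? ?] ?] ?] /=; congr (_, _, _, _); ring.
by rewrite hscale_eq0 ?expf_neq0 ?mulf_neq0 //; case: ifP.
Qed.

Lemma hopp_scale (c : F) u : hopp (hscale c u) = hscale c (hopp u).
Proof. by case: u => [[[X Y] T] Z] /=; rewrite mulrN. Qed.

Lemma jq_addE (p q : jq_rep eps delta) :
  jq_add (\pi p) (\pi q) = \pi_(jq eps delta) (jq_rep_add p q).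
Proof.
have [c c0 hp] := repr_pi p; have [d d0 hq] := repr_pi q.
apply/esym/(@eq_jq _ _ ((c * d) ^+ 2)); first by rewrite expf_neq0 ?mulf_neq0.
by rewrite /= hp hq hadd_scale.
Qed.

Lemma jq_oppE (p : jq_rep eps delta) :
  jq_opp (\pi p) = \pi_(jq eps delta) (jq_rep_opp p).
Proof.
have [c c0 hp] := repr_pi p; apply/esym/(@eq_jq _ _ c) => //=.
by rewrite hp hopp_scale.
Qed.

Lemma jq_wE (p : jq_rep eps delta) :
  jq_w (\pi_(jq eps delta) p) =
    let: (X, Y, T, Z) := val p in
    if Z == 0 then None else Some (delta * (X / Z) ^+ 2).
Proof.
rewrite /jq_w; have [c c0 ->] := repr_pi p.
case: (val p) => [[[X Y] T] Z] /=; rewrite mulf_eq0 (negPf c0) /=.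
by case: eqVneq => // Z0; rewrite -mulf_div divff // mul1r.
Qed.

Lemma on_jq_affine (x y : F) :
  y ^+ 2 = eps * x ^+ 4 + 2 * delta * x ^+ 2 + 1 -> on_jq eps delta (x, y, x ^+ 2, 1).
Proof.
move=> h; rewrite /on_jq /hcoords0 hcoords_eq oner_eq0 !andbF mulr1 eqxx /=.
by rewrite h -exprM expr1n.
Qed.

Definition jq_affine (x y : F)
    (h : y ^+ 2 = eps * x ^+ 4 + 2 * delta * x ^+ 2 + 1) : jq eps delta :=
  \pi_(jq eps delta) (exist (on_jq eps delta) _ (on_jq_affine h)).

Lemma jq_w_affine (x y : F) h : jq_w (@jq_affine x y h) = Some (delta * x ^+ 2).
Proof. by rewrite jq_wE /= oner_eq0 divr1. Qed.

Lemma jq_add_affine (x1 y1 x2 y2 x3 y3 : F) h1 h2 h3 :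
  let D := 1 - eps * x1 ^+ 2 * x2 ^+ 2 in
  D != 0 ->
  x3 = (x1 * y2 + x2 * y1) / D ->
  y3 = ((y1 * y2 + 2 * delta * x1 * x2) * (1 + eps * x1 ^+ 2 * x2 ^+ 2)
        + 2 * eps * x1 * x2 * (x1 ^+ 2 + x2 ^+ 2)) / D ^+ 2 ->
  jq_add (@jq_affine x1 y1 h1) (@jq_affine x2 y2 h2) = @jq_affine x3 y3 h3.
Proof.
move=> D D0 hx hy; rewrite jq_addE.
apply/esym/(@eq_jq _ _ (D ^+ 2)); rewrite ?expf_neq0 //=.
rewrite /hadd /haddl /hcoords0 hcoords_eq !mulr1 -/D.
rewrite [D ^+ 2 == 0]expf_eq0 /= (negPf D0) !andbF /= hx hy.
by congr (_, _, _, _); field.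
Qed.

Lemma jq_origin_eq : (1 : F) ^+ 2 = eps * 0 ^+ 4 + 2 * delta * 0 ^+ 2 + 1.
Proof. by rewrite !expr0n /= expr1n !mulr0 !add0r. Qed.

Definition jq_origin : jq eps delta := jq_affine jq_origin_eq.

Lemma jq_addC : commutative jq_add.
Proof.
move=> P Q; apply: (@eq_jq _ _ 1); rewrite ?oner_neq0 //= hscale1 /hadd.
case: (val (repr P)) (val (repr Q)) => [[[X1 Y1] T1] Z1] [[[X2 Y2] T2] Z2].
have -> : haddl eps delta (X2, Y2, T2, Z2) (X1, Y1, T1, Z1)
        = haddl eps delta (X1, Y1, T1, Z1) (X2, Y2, T2, Z2).
  by rewrite /haddl; congr (_, _, _, _); ring.
have -> // : haddr eps delta (X2, Y2, T2, Z2) (X1, Y1, T1, Z1)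
        = haddr eps delta (X1, Y1, T1, Z1) (X2, Y2, T2, Z2).
  by rewrite /haddr; congr (_, _, _, _); ring.
Qed.

Lemma jq_add0 (P : jq eps delta) : jq_add P jq_origin = P.
Proof.
elim/quotW: P => p; rewrite jq_addE; apply/esym.
case: p => [[[[X Y] T] Z] h].
have [hu /eqP hX /eqP hY] := and3P h.
have [Z0|Z0] := eqVneq Z 0.
- have X0 : X = 0 by apply/eqP; rewrite -sqrf_eq0 hX Z0 mulr0.
  have T0 : T != 0.
    apply/eqP => T0; move: hu hY; rewrite /hcoords0 hcoords_eq Z0 X0 T0.
    rewrite !expr0n /= !mulr0 !addr0 !eqxx !andbT /= => Y0 /eqP.
    by rewrite expf_eq0 /= (negPf Y0).
  apply: (@eq_jq _ _ T) => //=; rewrite /hadd.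
  have -> /= : haddl eps delta (X, Y, T, Z) (0, 1, 0 ^+ 2, 1) = hcoords0 F.
    by rewrite /haddl /hcoords0 Z0 X0; congr (_, _, _, _); ring.
  by rewrite eqxx /= Z0 X0; congr (_, _, _, _); ring.
- apply: (@eq_jq _ _ Z) => //=; rewrite /hadd.
  have -> : haddl eps delta (X, Y, T, Z) (0, 1, 0 ^+ 2, 1) = hscale Z (X, Y, T, Z).
    by rewrite /haddl /=; congr (_, _, _, _); ring: hX.
  by rewrite hscale_eq0 // hu.
Qed.

Lemma jq_addN (P : jq eps delta) : jq_add P (jq_opp P) = jq_origin.
Proof.
elim/quotW: P => p; rewrite jq_oppE jq_addE; apply/esym.
have hoN := valP (jq_rep_opp p).
case: p hoN => [[[[X Y] T] Z] h] hN.
have noz := hadd_no_common_zero h hN.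
have [hu /eqP hX /eqP hY] := and3P h; rewrite hX in hY.
have el : haddl eps delta (X, Y, T, Z) (- X, Y, T, Z)
    = hscale ((Z ^+ 2 - eps * T ^+ 2) ^+ 2) (0, 1, 0 ^+ 2, 1).
  by rewrite /haddl /=; congr (_, _, _, _); ring: hX hY.
have er : haddr eps delta (X, Y, T, Z) (- X, Y, T, Z)
    = hscale ((2 * X * Y) ^+ 2) (0, 1, 0 ^+ 2, 1).
  by rewrite /haddr /=; congr (_, _, _, _); ring: hX hY.
have s0 (c : F) u : hscale c u != hcoords0 F -> c != 0.
  apply: contraNneq => ->; case: u => [[[? ?] ?] ?].
  by rewrite /= !mul0r.
have [l0|l0] := eqVneq (haddl eps delta (X, Y, T, Z) (- X, Y, T, Z)) (hcoords0 F).
- apply: (@eq_jq _ _ ((2 * X * Y) ^+ 2)).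
    by apply: (s0 _ (0, 1, 0 ^+ 2, 1)); rewrite -er; apply/eqP => /(noz l0).
  by rewrite /= /hadd l0 eqxx /= -/(haddr _ _ (_, _, _, _) (_, _, _, _)) er.
- apply: (@eq_jq _ _ ((Z ^+ 2 - eps * T ^+ 2) ^+ 2)).
    by apply: (s0 _ (0, 1, 0 ^+ 2, 1)); rewrite -el.
  by rewrite /= /hadd l0 el.
Qed.

End GroupLaw.

(* Main.v *)
Require Import Defs.
From mathcomp Require Import all_boot all_algebra.
From mathcomp Require Import ring.

Import GRing.Theory.
Local Open Scope ring_scope.

(** A finite value of [w] at a point means that the point is affine, so that
    [P1 = (x1, y1)], [P2 = (x2, y2)], [w1 = delta * x1 ^+ 2] and
    [w2 = delta * x2 ^+ 2].  Put
    [D = 1 - eps * x1 ^+ 2 * x2 ^+ 2]; since [t * w1 * w2 = eps * x1 ^+ 2 * x2 ^+ 2],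
    the hypothesis on [w1 * w2] says that [D != 0], and the one on [w1 ^+ 2] says the
    same of the denominator [1 - eps * x1 ^+ 4] of the doubling formula
    ([affine_denominator_neq0]).  So the generic addition formula gives [w] at
    [P1 + P2], [P2 - P1] and [2 P1] ([jq_w_add_affine]).
    Negation only changes the sign of [x], hence [P1 + P2] and [P2 - P1]
    have abscissae [(x1 * y2 + x2 * y1) / D] and
    [(x2 * y1 - x1 * y2) / D], whose product is
    [(x2 ^+ 2 * y1 ^+ 2 - x1 ^+ 2 * y2 ^+ 2) / D ^+ 2].  Eliminating [y1] and [y2]
    with the curve equation turns the numerator into [(x2 ^+ 2 - x1 ^+ 2) * D]: one
    factor [D] cancels and only squares of abscissae are left, which is the formula
    for [w3 * w0].  The doubling formula is the same elimination in
    [(2 * x1 * y1 / (1 - eps * x1 ^+ 4)) ^+ 2]. *)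

Lemma jq_w_finite_affine (F : finFieldType) (eps delta : F) (P : jq eps delta) (w : F) :
  jq_w P = Some w ->
  exists x y (h : y ^+ 2 = eps * x ^+ 4 + 2 * delta * x ^+ 2 + 1),
    P = jq_affine h /\ w = delta * x ^+ 2.
Proof.
elim/quotW: P => -[[[[X Y] T] Z] on]; rewrite jq_wE /=.
have [_ /eqP hX /eqP hY] := and3P on.
case: eqVneq => // Z0 [<-].
have hT : T = X ^+ 2 / Z by rewrite hX mulfK.
have h : (Y / Z) ^+ 2 = eps * (X / Z) ^+ 4 + 2 * delta * (X / Z) ^+ 2 + 1.
  by rewrite expr_div_n hY hT; field.
exists (X / Z), (Y / Z), h; split=> //.
apply/esym/(@eq_jq _ _ _ _ _ Z) => //=; rewrite hT.
by congr (_, _, _, _); field.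
Qed.

Lemma jq_opp_affine (F : finFieldType) (eps delta x y : F)
    (h : y ^+ 2 = eps * x ^+ 4 + 2 * delta * x ^+ 2 + 1)
    (h' : y ^+ 2 = eps * (- x) ^+ 4 + 2 * delta * (- x) ^+ 2 + 1) :
  jq_opp (jq_affine h) = jq_affine h'.
Proof.
rewrite jq_oppE; apply: (@eq_jq _ _ _ _ _ 1); first exact: oner_neq0.
by rewrite hscale1 /= sqrrN.
Qed.

Section FiniteSum.
Variables (F : finFieldType) (eps delta : F).
Hypotheses (char_odd : 2%N \notin [pchar F])
           (nonsing : eps * (delta ^+ 2 - eps) != 0).

(** When the denominator [D] is nonzero the first addition law does not vanish, since
    its last coordinate is [D ^+ 2], and it therefore computes the sum. *)
Lemma jq_w_add_affine (x1 y1 x2 y2 : F)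
    (h1 : y1 ^+ 2 = eps * x1 ^+ 4 + 2 * delta * x1 ^+ 2 + 1)
    (h2 : y2 ^+ 2 = eps * x2 ^+ 4 + 2 * delta * x2 ^+ 2 + 1) :
  let D := 1 - eps * x1 ^+ 2 * x2 ^+ 2 in
  D != 0 ->
  jq_w (jq_add char_odd nonsing (jq_affine h1) (jq_affine h2))
    = Some (delta * ((x1 * y2 + x2 * y1) / D) ^+ 2).
Proof.
move=> D D0; rewrite jq_addE jq_wE /= /hadd /haddl /hcoords0 hcoords_eq !mulr1 -/D.
rewrite [D ^+ 2 == 0]expf_eq0 /= (negPf D0) !andbF /= expf_eq0 /= (negPf D0).
by congr (Some (delta * _ ^+ 2)); field.
Qed.

End FiniteSum.

Lemma affine_denominator_neq0 (F : fieldType) (eps delta a b : F) :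
  eps != 0 -> (delta * a) * (delta * b) != delta ^+ 2 / eps ->
  1 - eps * a * b != 0.
Proof.
move=> eps0; apply: contraNneq => /subr0_eq e.
by apply/eqP; rewrite -[in RHS](mulr1 (delta ^+ 2)) e; field.
Qed.

Theorem proposition2 (F : finFieldType) (eps delta : F)
  (char_odd : 2%N \notin [pchar F])
  (nonsing : eps * (delta ^+ 2 - eps) != 0)
  (delta_neq0 : delta != 0)
  (P1 P2 : jq eps delta) (w0 w1 w2 w3 w4 : F) :
  jq_w (jq_sub char_odd nonsing P2 P1) = Some w0 ->
  jq_w P1 = Some w1 ->
  jq_w P2 = Some w2 ->
  jq_w (jq_add char_odd nonsing P1 P2) = Some w3 ->
  jq_w (jq_add char_odd nonsing P1 P1) = Some w4 ->
  w1 * w2 != delta ^+ 2 / eps ->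
  w1 ^+ 2 != delta ^+ 2 / eps ->
  let t := eps / delta ^+ 2 in
  w4 = 4 * w1 * (t * w1 ^+ 2 + 1 + 2 * w1) / (t * w1 ^+ 2 - 1) ^+ 2 /\
  w3 * w0 = (w1 - w2) ^+ 2 / (t * w1 * w2 - 1) ^+ 2.
Proof.
move=> e0 /jq_w_finite_affine[x1 [y1 [h1 [eP1 ->]]]].
move=> /jq_w_finite_affine[x2 [y2 [h2 [eP2 ->]]]].
move: e0; rewrite {}eP1 {}eP2.
have eps0 : eps != 0 by move: nonsing; rewrite mulf_eq0 negb_or => /andP[].
have h1N : y1 ^+ 2 = eps * (- x1) ^+ 4 + 2 * delta * (- x1) ^+ 2 + 1.
  by rewrite h1; ring.
rewrite /jq_sub (jq_opp_affine _ _ _ _ _ h1 h1N) => e0 e3 e4.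
move=> /(affine_denominator_neq0 _ _ _ _ _ eps0) D12.
rewrite expr2 => /(affine_denominator_neq0 _ _ _ _ _ eps0) D11.
set t := eps / delta ^+ 2.
have D21N : 1 - eps * x2 ^+ 2 * (- x1) ^+ 2 != 0.
  by rewrite sqrrN mulrAC.
move: e0 e3 e4; rewrite !jq_w_add_affine // => -[<-] [<-] [<-].
have -> : t * (delta * x1 ^+ 2 * (delta * x1 ^+ 2)) = eps * x1 ^+ 2 * x1 ^+ 2.
  by rewrite /t; field.
have -> : t * (delta * x1 ^+ 2) * (delta * x2 ^+ 2) = eps * x1 ^+ 2 * x2 ^+ 2.
  by rewrite /t; field.
rewrite -![eps * _ * _ - 1]opprB !sqrrN; split.
- rewrite expr_div_n [LHS]mulrA; congr (_ / _).
  have -> : x1 * y1 + x1 * y1 = 2 * x1 * y1 by ring.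
  by rewrite exprMn h1; ring.
- rewrite [eps * x2 ^+ 2 * _]mulrAC.
  set D := 1 - _ in D12 *.
  have eN : (x1 * y2 + x2 * y1) * (x2 * y1 + - x1 * y2) = (x2 ^+ 2 - x1 ^+ 2) * D.
    have -> : (x1 * y2 + x2 * y1) * (x2 * y1 + - x1 * y2)
            = x2 ^+ 2 * y1 ^+ 2 - x1 ^+ 2 * y2 ^+ 2 by ring.
    by rewrite h1 h2 /D; ring.
  (* The two abscissae are paired up so that only their product is squared. *)
  transitivity (delta ^+ 2
      * ((x1 * y2 + x2 * y1) * (x2 * y1 + - x1 * y2) / D ^+ 2) ^+ 2).
    by field.
  by rewrite eN; field.
Qed.
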